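(* Suppose that for every $i\in\mathcal N$ the control function $f_i:\mathbb R\to\mathbb R$ is nonincreasing over $\mathbb R$, strictly decreasing and differentiable on $(-\infty,-\delta_i/2)\cup(\delta_i/2,\infty)$, and that there is a finite $\alpha_i$ with $|f_i'(u)|\le\alpha_i$ for all $u$ in the appropriate domain (where $f_i$ is differentiable). Let $\mathcal B=\mathrm{diag}\{\beta_i\}_{i\in\mathcal N}$ with $\beta_i=\frac{1}{1/\alpha_i+2X_{ii}}$, and let $\bar X$ be the matrix obtained from $X$ by setting its diagonal entries to $0$. If $$\sigma_{\max}(\mathcal B\bar X)<1,$$ then the signal-anticipating voltage control $$q_i(t+1)=\arg\min_{q_i\in\Omega_i}\ C_i(q_i)+q_i\Big(X_{ii}q_i+\sum_{j\in\mathcal N\setminus\{i\}}X_{ij}q_j(t)+\Delta\tilde v_i\Big),\qquad i\in\mathcal N,$$ converges (from any initial $q(0)\in\Omega$) to the unique Nash equilibrium of the voltage control game $\mathcal G$. Moreover, it converges exponentially fast to the equilibrium.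
   Context: Network: a rooted tree with node set $\mathcal N\cup\{0\}$, $\mathcal N=\{1,\dots,n\}$, root $0$, and set of lines (edges) $\mathcal L$; each line $(h,k)\in\mathcal L$ has reactance $x_{hk}>0$. $\mathcal L_i\subseteq\mathcal L$ is the set of lines on the unique path from $0$ to $i$. The reactance matrix $X\in\mathbb R^{n\times n}$ is $X_{ij}=\sum_{(h,k)\in\mathcal L_i\cap\mathcal L_j}x_{hk}$; it is symmetric positive definite. $\Delta\tilde v\in\mathbb R^n$ is a given constant vector. For each $i\in\mathcal N$: $\delta_i\ge 0$; $f_i:\mathbb R\to\mathbb R$ is a control function with $f_i(u)=0$ for $u\in[-\delta_i/2,\delta_i/2]$; $\Omega_i=\{q_i: q_i^{\min}\le q_i\le q_i^{\max}\}$ is a nonempty closed interval; $\Omega=\times_{i\in\mathcal N}\Omega_i$. The cost function of node $i$ is $C_i(q_i)=-\int_0^{q_i}f_i^{-1}(q)\,dq$, where $f_i^{-1}$ is the inverse of $f_i$ (the value assigned at $q=0$ is immaterial to the integral; it is implicit that $f_i^{-1}$ is defined at all nonzero points between $0$ and points of $\Omega_i$, so that $C_i$ is well defined on $\Omega_i$). Voltage control game $\mathcal G$: the players are the nodes $i\in\mathcal N$, the strategy space of $i$ is $\Omega_i$, and the cost function of $i$ is $h_i(q)=C_i(q_i)+q_i\big(\sum_{j\in\mathcal N}X_{ij}q_j+\Delta\tilde v_i\big)$, also written $h_i(q_i,q_{-i})$. A vector $q^a\in\Omega$ is a Nash equilibrium if for all $i\in\mathcal N$, $h_i(q_i^a,q_{-i}^a)\le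 h_i(q_i,q_{-i}^a)$ for all $q_i\in\Omega_i$. $\sigma_{\max}$ denotes the maximum singular value. Exponentially fast convergence to $q^a$ means $\|q(t)-q^a\|_2\le c\rho^t$ for some $c\ge0$, $\rho\in[0,1)$ and all $t\ge 0$. *)

(* Defs.v *)
From HB Require Import structures.
From mathcomp Require Export all_boot all_order all_algebra.
From mathcomp Require Export all_classical all_reals all_analysis.
Export Order.TTheory GRing.Theory Num.Theory numFieldNormedType.Exports.

#[export] Set Implicit Arguments.
#[export] Unset Strict Implicit.
#[export] Unset Printing Implicit Defensive.

Open Scope classical_set_scope.
Open Scope ring_scope.

(** The network has vertex type ['I_n.+1]: the root is [ord0], and node
    [i : 'I_n] is the vertex [lift ord0 i], with value [i + 1].
    A line is an unordered pair of vertices, i.e. a two-element set. *)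

Definition adj (n : nat) (L : {set {set 'I_n.+1}}) : rel 'I_n.+1 :=
  fun u v => [set u; v]%SET \in L.

(* A cycle of size at most 2 runs back and forth along one line. *)
Definition is_tree (n : nat) (L : {set {set 'I_n.+1}}) : Prop :=
  [/\ forall e, e \in L -> #|e| = 2%N,
      forall u v, connect (adj L) u v
    & forall c : seq 'I_n.+1, ucycle (adj L) c -> (size c <= 2)%N].

Definition path_lines (n : nat) (u : 'I_n.+1) (p : seq 'I_n.+1) :
    seq {set 'I_n.+1} :=
  [seq [set e.1; e.2]%SET | e <- zip (u :: p) p].

(* In a tree, the path [ord0 :: p] below is unique. *)
Definition lines_to_root (n : nat) (L : {set {set 'I_n.+1}}) (i : 'I_n) :
    {set {set 'I_n.+1}} :=
  [set e in L | `[< exists p : seq 'I_n.+1,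
     [/\ path (adj L) ord0 p, uniq (ord0 :: p), last ord0 p = lift ord0 i
       & e \in path_lines ord0 p] >]]%SET.

Definition reactance_mx (R : realType) (n : nat) (L : {set {set 'I_n.+1}})
    (x : {set 'I_n.+1} -> R) : 'M[R]_n :=
  \matrix_(i, j)
    \sum_(e in (lines_to_root L i :&: lines_to_root L j)%SET) x e.

Definition offdiag_mx (R : realType) (n : nat) (A : 'M[R]_n) : 'M[R]_n :=
  \matrix_(i, j) (if i == j then 0 else A i j).

(* The set is finite, and nonempty for [n > 0], so the supremum is a maximum;
   for [n = 0] it is [sup set0 = 0]. *)
Definition sigma_max (R : realType) (n : nat) (A : 'M[R]_n) : R :=
  sup [set Num.sqrt l | l in [set l : R | eigenvalue (A^T *m A) l]].

Definition norm2 (R : realType) (n : nat) (v : 'cV[R]_n) : R :=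
  Num.sqrt (\sum_i v i 0 ^+ 2).

(* Some preimage of [q] under [f] (0 if there is none). Where [f] takes the
   value [q] exactly once, this is the usual inverse. *)
Definition finv (R : realType) (f : R -> R) (q : R) : R :=
  xget 0 [set u | f u = q].

Definition oriented_integral (R : realType) (a b : R) (g : R -> R) : R :=
  if a <= b then (\int[lebesgue_measure]_(q in `[a, b]) g q)%R
  else - (\int[lebesgue_measure]_(q in `[b, a]) g q)%R.

Definition node_cost (R : realType) (f : R -> R) (y : R) : R :=
  - oriented_integral 0 y (finv f).

Definition strategy (R : realType) (n : nat) (qmin qmax : 'I_n -> R) (i : 'I_n) :
    set R :=
  [set y | qmin i <= y <= qmax i].

Definition profiles (R : realType) (n : nat) (qmin qmax : 'I_n -> R) :
    set 'cV[R]_n :=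
  [set q | forall i, strategy qmin qmax i (q i 0)].

Definition game_cost (R : realType) (n : nat) (f : 'I_n -> R -> R)
    (X : 'M[R]_n) (dv : 'cV[R]_n) (i : 'I_n) (q : 'cV[R]_n) : R :=
  node_cost (f i) (q i 0) + q i 0 * (\sum_j X i j * q j 0 + dv i 0).

Definition deviate (R : realType) (n : nat) (q : 'cV[R]_n) (i : 'I_n) (y : R) :
    'cV[R]_n :=
  \col_j (if j == i then y else q j 0).

Definition nash_equilibrium (R : realType) (n : nat) (qmin qmax : 'I_n -> R)
    (f : 'I_n -> R -> R) (X : 'M[R]_n) (dv qa : 'cV[R]_n) : Prop :=
  profiles qmin qmax qa /\
  forall (i : 'I_n) (y : R), strategy qmin qmax i y ->
    game_cost f X dv i qa <= game_cost f X dv i (deviate qa i y).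

Definition argmin_set (R : realType) (F : R -> R) (A : set R) : set R :=
  [set y | A y /\ forall z, A z -> F y <= F z].

(* The argument [q] is the current profile [q(t)]. *)
Definition anticipating_objective (R : realType) (n : nat) (f : 'I_n -> R -> R)
    (X : 'M[R]_n) (dv q : 'cV[R]_n) (i : 'I_n) (y : R) : R :=
  node_cost (f i) y +
  y * (X i i * y + \sum_(j | j != i) X i j * q j 0 + dv i 0).

Definition anticipating_control (R : realType) (n : nat) (qmin qmax : 'I_n -> R)
    (f : 'I_n -> R -> R) (X : 'M[R]_n) (dv : 'cV[R]_n) (q : nat -> 'cV[R]_n) :
    Prop :=
  profiles qmin qmax (q 0%N) /\
  forall (t : nat) (i : 'I_n),
    argmin_set (anticipating_objective f X dv (q t) i) (strategy qmin qmax i)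
      (q t.+1 i 0).

Definition exp_converges (R : realType) (n : nat) (q : nat -> 'cV[R]_n)
    (qa : 'cV[R]_n) : Prop :=
  exists c rho : R, [/\ 0 <= c, 0 <= rho < 1
    & forall t : nat, norm2 (q t - qa) <= c * rho ^+ t].

(* Main.v *)
Require Import Defs.
From mathcomp Require Import ring lra measurable_realfun.

(** The control is a best-response iteration, and the plan is to show that the
    best response is a contraction for the Euclidean norm.

    Fix a node.  Because [f] has slope at most [alpha], its inverse has slope
    at most [- 1 / alpha], also across the deadband: there [finv f] may jump,
    but it jumps downwards ([finv_strongly_decreasing]).  Hence the cost
    [- \int finv f] is strongly convex with modulus [1 / alpha], and adding
    [y * (X i i * y + c)] raises the modulus to [1 / alpha + 2 * X i i], which
    is the reciprocal of the node's entry in the diagonal matrix [B].  A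
    strongly convex function of modulus [M] on a segment has exactly one
    minimizer, and tilting the function by [c * y] moves it by at most
    [`|c| / M] ([strongly_convex_argmin_lipschitz]).  The tilt between two
    profiles [p] and [q] is the entry of [offdiag_mx X *m (p - q)], so the best
    responses to [p] and [q] differ, entry by entry, by at most the absolute
    value of [B *m offdiag_mx X *m (p - q)].

    It remains to see that [sigma_max] is an operator norm bound
    ([norm2_mulmx_le]).  The maximum of [norm2 (A *m u)] over the unit sphere
    exists by compactness, and a maximizer is an eigenvector of [A^T *m A].

    So the best response is Lipschitz with ratio [sigma_max < 1].  On the
    compact set of profiles the distance from a point to its image attains its
    minimum, which the contraction forces to be 0; this gives a fixed point.
    Fixed points are exactly the Nash equilibria, because a deviation changes
    the game cost of a node to its anticipating objective.  Iterating the
    contraction gives uniqueness and the geometric rate. *)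

(** * Integrals of strongly decreasing functions *)

Section Integral.
Context {R : realType}.
Implicit Types (a b m : R) (g : R -> R).
Notation mu := (@lebesgue_measure R).

Definition strongly_decreasing_on m a b g : Prop :=
  forall s t : R, a <= s -> s <= t -> t <= b -> g t + m * (t - s) <= g s.

Lemma integrable_affine c k a b :
  mu.-integrable `[a, b] (EFin \o (fun s : R => c + k * s)).
Proof.
apply: continuous_compact_integrable; first exact: segment_compact.
apply: continuous_subspaceT => t.
by apply: cvgD; [exact: cvg_cst|apply: cvgM; [exact: cvg_cst|exact: cvg_id]].
Qed.

Lemma Rintegral_affine c k a b : a <= b ->
  (\int[mu]_(s in `[a, b]) (c + k * s))%R =
  c * (b - a) + k * (b ^+ 2 - a ^+ 2) / 2.
Proof.
rewrite le_eqVlt => /predU1P[<-|ab].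
  by rewrite set_itv1 Rintegral_set1 !subrr !mulr0 mul0r addr0.
pose G := fun s : R => c * s + k / 2 * s ^+ 2.
have dG (t : R) : is_derive t 1 G (c + k * t).
  rewrite /G; apply: is_derive_eq.
  by rewrite /GRing.scale/= !mulr1; field.
have cG : continuous G.
  by move=> t; apply/differentiable_continuous/derivable1_diffP; case: (dG t).
rewrite /Rintegral (@continuous_FTC2 _ _ G a b)//=.
- by rewrite /G; field.
- apply: continuous_subspaceT => t.
  by apply: cvgD; [exact: cvg_cst|apply: cvgM; [exact: cvg_cst|exact: cvg_id]].
- split.
  + by move=> t _; case: (dG t).
  + by apply: cvg_at_right_filter; exact: cG.
  + by apply: cvg_at_left_filter; exact: cG.
- by move=> t _; rewrite derive1E; case: (dG t).
Qed.

(** A monotone function is measurable, and on a segment it is bounded by its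
    values at the ends. *)
Lemma strongly_decreasing_integrable m a b g : 0 <= m ->
  strongly_decreasing_on m a b g -> mu.-integrable `[a, b] (EFin \o g).
Proof.
move=> m0 gP.
have [ab|ba] := leP a b; last first.
  by rewrite set_itv_ge ?bnd_simp -?ltNge//; exact: integrable_set0.
have gle s t : a <= s -> s <= t -> t <= b -> g t <= g s.
  move=> as_ st tb; apply: le_trans (gP s t as_ st tb).
  by rewrite lerDl mulr_ge0// subr_ge0.
(* clamping the argument to [a, b] makes g monotone on the whole line *)
pose gc t := g (Num.max a (Num.min t b)).
have gcE : {in `[a, b]%classic, gc =1 g}.
  move=> t; rewrite inE/= in_itv/= => /andP[at_ tb].
  by rewrite /gc min_l// max_r.
apply: measurable_bounded_integrable => //=.
- by rewrite lebesgue_measure_itv/= lte_fin; case: ifP => _; rewrite -?EFinD ltry.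
- apply: (eq_measurable_fun gc gcE).
  apply: nonincreasing_measurable => // s t st; rewrite /gc; apply: gle.
  + by rewrite le_max lexx.
  + by rewrite ge_max !le_max lexx/= le_min !ge_min st lexx !orbT.
  + by rewrite ge_max ab ge_min lexx orbT.
- exists (Num.max `|g a| `|g b|); split => // x Mx t /=.
  rewrite in_itv/= => /andP[at_ tb]; apply: le_trans (ltW Mx).
  have h1 := gle a t (lexx a) at_ tb; have h2 := gle t b at_ tb (lexx b).
  rewrite ler_norml le_max; apply/andP; split.
    rewrite lerNl le_max; apply/orP; right.
    by have := ler_norm (- g b); rewrite normrN; lra.
  by apply/orP; left; apply: le_trans h1 (ler_norm _).
Qed.

(** On [[s, t]] the graph of [g] lies above the line of slope [- m] through its
    right end and below the one through its left end; both lines have an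
    explicit integral. *)
Lemma Rintegral_strongly_decreasing m a b g s t : 0 <= m ->
    strongly_decreasing_on m a b g -> a <= s -> s <= t -> t <= b ->
  g t * (t - s) + m / 2 * (t - s) ^+ 2 <= (\int[mu]_(x in `[s, t]) g x)%R
    <= g s * (t - s) - m / 2 * (t - s) ^+ 2.
Proof.
move=> m0 gP as_ st tb.
have ig : mu.-integrable `[s, t] (EFin \o g).
  apply: strongly_decreasing_integrable m0 _ => x y sx xy yt.
  by apply: gP => //; [exact: le_trans sx|exact: le_trans yt tb].
apply/andP; split.
- rewrite [leLHS](_ : _ =
      (\int[mu]_(x in `[s, t]) ((g t + m * t) + (- m) * x))%R).
    apply: le_Rintegral => //; first exact: integrable_affine.
    move=> x /=; rewrite in_itv/= => /andP[sx xt].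
    by have := gP x t (le_trans as_ sx) xt tb; lra.
  by rewrite Rintegral_affine//; field.
- rewrite [leRHS](_ : _ =
      (\int[mu]_(x in `[s, t]) ((g s + m * s) + (- m) * x))%R).
    apply: le_Rintegral => //; first exact: integrable_affine.
    move=> x /=; rewrite in_itv/= => /andP[sx xt].
    by have := gP s x as_ sx (le_trans xt tb); lra.
  by rewrite Rintegral_affine//; field.
Qed.

Lemma Rintegral_itv_chasles a b c g : a <= b -> b <= c ->
    mu.-integrable `[a, c] (EFin \o g) ->
  (\int[mu]_(x in `[a, c]) g x =
   \int[mu]_(x in `[a, b]) g x + \int[mu]_(x in `[b, c]) g x)%R.
Proof.
move=> ab bc ig; rewrite [RHS]addrC; apply/eqP; rewrite -subr_eq; apply/eqP.
rewrite -[RHS]Rintegral_itv_obnd_cbnd.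
  by rewrite Rintegral_itvB// ?bnd_simp.
apply: integrableS ig => //= x /=; rewrite !in_itv/= => /andP[bx ->].
by rewrite andbT (le_trans ab)// ltW.
Qed.

Lemma oriented_integralB m a b g s t : 0 <= m ->
    strongly_decreasing_on m a b g -> a <= 0 -> 0 <= b ->
    a <= s -> s <= t -> t <= b ->
  oriented_integral 0 t g - oriented_integral 0 s g =
  (\int[mu]_(x in `[s, t]) g x)%R.
Proof.
move=> m0 gP a0 b0 as_ st tb.
have ig c d : a <= c -> d <= b -> mu.-integrable `[c, d] (EFin \o g).
  move=> ac db; apply: strongly_decreasing_integrable m0 _ => x y cx xy yd.
  by apply: gP => //; [exact: le_trans cx|exact: le_trans yd db].
rewrite /oriented_integral; case: (leP 0 s) => s0.
  rewrite (le_trans s0 st) (@Rintegral_itv_chasles 0 s t)//; last exact: ig.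
  by rewrite addrC addKr.
case: (leP 0 t) => t0.
  by rewrite opprK addrC -Rintegral_itv_chasles//; [exact: ltW|exact: ig].
rewrite opprK addrC (@Rintegral_itv_chasles s t 0)//; [|exact: ltW|exact: ig].
by rewrite addrK.
Qed.

End Integral.

(** * Strong convexity on a segment *)

Section StrongConvexity.
Context {R : realType}.
Implicit Types (a b c d m k M : R) (g F G : R -> R).
Notation mu := (@lebesgue_measure R).

(** [G] is a selection of subgradients of [F].  It is kept explicit instead of
    the derivative of [F], which the node cost need not have at 0, where
    [finv f] may jump over the deadband. *)
Definition strongly_convex_on M a b F G : Prop :=
  forall y z : R, a <= y <= b -> a <= z <= b ->
    F y + G y * (z - y) + M / 2 * (z - y) ^+ 2 <= F z.

(** The increments of the potential are integrals of [g], so the affine bounds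
    on these integrals are the subgradient inequality; the cases [y <= z] and
    [z < y] use one bound each. *)
Lemma oriented_integral_strongly_convex m a b g : 0 <= m ->
    strongly_decreasing_on m a b g -> a <= 0 -> 0 <= b ->
  strongly_convex_on m a b (fun y => - oriented_integral 0 y g) (fun y => - g y).
Proof.
move=> m0 gP a0 b0 y z /andP[ay yb] /andP[az zb].
have [yz|zy] := leP y z.
  have := oriented_integralB m0 gP a0 b0 ay yz zb.
  have := Rintegral_strongly_decreasing m0 gP ay yz zb.
  set I := (\int[mu]_(x in _) _)%R; lra.
have := oriented_integralB m0 gP a0 b0 az (ltW zy) yb.
have := Rintegral_strongly_decreasing m0 gP az (ltW zy) yb.
rewrite -[(y - z) ^+ 2]sqrrN opprB.
set I := (\int[mu]_(x in _) _)%R; lra.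
Qed.

Lemma strongly_convex_onS M a b c d F G : a <= c -> d <= b ->
  strongly_convex_on M a b F G -> strongly_convex_on M c d F G.
Proof.
move=> ac db FG y z /andP[cy yd] /andP[cz zd].
by apply: FG; apply/andP; split; lra.
Qed.

Lemma strongly_convex_onD_quadratic M a b F G k c :
  strongly_convex_on M a b F G ->
  strongly_convex_on (M + 2 * k) a b (fun y => F y + y * (k * y + c))
    (fun y => G y + 2 * k * y + c).
Proof.
move=> FG y z yab zab; apply: le_trans (lerD (FG y z yab zab) (lexx _)).
by rewrite le_eqVlt; apply/orP; left; apply/eqP; field.
Qed.

(** Subgradients increase, so they are bounded on the segment by their values
    at its ends, and [F] is Lipschitz. *)
Lemma strongly_convex_on_continuous M a b F G : 0 <= M ->
  strongly_convex_on M a b F G -> {within `[a, b], continuous F}.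
Proof.
move=> M0 FG.
have [ab|ba] := leP a b; last first.
  rewrite set_itv_ge ?bnd_simp -?ltNge//; exact: continuous_subspace0.
have aab : a <= a <= b by rewrite lexx.
have bab : a <= b <= b by rewrite lexx andbT.
have FGl y z : a <= y <= b -> a <= z <= b -> F y + G y * (z - y) <= F z.
  move=> yab zab; apply: le_trans (FG y z yab zab).
  by rewrite lerDl mulr_ge0 ?sqr_ge0// divr_ge0.
have Gmono y z : a <= y <= b -> a <= z <= b -> y <= z -> G y <= G z.
  move=> yab zab; rewrite le_eqVlt => /predU1P[->//|yz].
  have h1 := FGl y z yab zab; have h2 := FGl z y zab yab.
  have : 0 <= (G z - G y) * (z - y) by lra.
  by rewrite pmulr_lge0 ?subr_gt0// subr_ge0.
pose K := `|G a| + `|G b| + 1.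
have GK y : a <= y <= b -> `|G y| <= K.
  move=> /[dup] yab /andP[ay yb].
  have h1 := Gmono _ _ aab yab ay; have h2 := Gmono _ _ yab bab yb.
  have := ler_norm (G b); have := ler_norm (- G a); rewrite normrN.
  have := normr_ge0 (G a); have := normr_ge0 (G b).
  by rewrite ler_norml /K => *; apply/andP; split; lra.
have K0 : 0 < K by rewrite ltr_wpDl// addr_ge0.
have FK y z : a <= y <= b -> a <= z <= b -> `|F y - F z| <= K * `|y - z|.
  move=> yab zab.
  have h1 := FGl y z yab zab; have h2 := FGl z y zab yab.
  have b1 : G y * (y - z) <= K * `|y - z|.
    by rewrite (le_trans (ler_norm _))// normrM ler_wpM2r// GK.
  have b2 : - (G z * (y - z)) <= K * `|y - z|.
    by rewrite (le_trans (ler_norm _))// normrN normrM ler_wpM2r// GK.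
  by rewrite ler_norml; apply/andP; split; lra.
apply/subspace_continuousP => y; rewrite /= in_itv/= => yab.
apply/cvgrPdist_le => e e0; rewrite near_withinE; near=> z.
rewrite /= in_itv/= => zab; apply: le_trans (FK y z yab zab) _.
rewrite mulrC -ler_pdivlMr//; near: z.
by apply: (@cvgr_dist_le _ _ _ (nbhs y) _ id y); [exact: cvg_id|exact: divr_gt0].
Unshelve. all: by end_near. Qed.

(** The subgradient [G y] at a minimizer [y] need not vanish, since [y] may be
    an end of the segment and [G] is only a selection.  The quadratic growth
    therefore comes from points [w] close to [y]: adding the subgradient
    inequalities of [w] at [y] and at [z] with weights that cancel [G w]
    compares [F y <= F w] with [F z]. *)
Lemma strongly_convex_argmin_growth M a b F G y z :
    strongly_convex_on M a b F G ->
    argmin_set F [set x | a <= x <= b] y -> a <= z <= b ->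
  F y + M / 2 * (z - y) ^+ 2 <= F z.
Proof.
move=> FG [yab ymin] zab; apply/ler_addgt0Pr => e e0.
pose D := M / 2 * (z - y) ^+ 2.
(* the step l makes the lost part l * D of the growth at most e *)
pose l := e / (e + `|D|).
have eD : 0 < e + `|D| by rewrite ltr_pwDl.
have l0 : 0 < l by exact: divr_gt0.
have l1 : l <= 1 by rewrite ler_pdivrMr// mul1r lerDl.
have lD : l * D <= e.
  rewrite (le_trans (ler_wpM2l (ltW l0) (ler_norm D)))//.
  rewrite /l mulrAC ler_pdivrMr// ler_pM2l//.
  by rewrite lerDr ltW.
pose w := y + l * (z - y).
have wab : a <= w <= b.
  rewrite (_ : w = (1 - l) * y + l * z); last by rewrite /w; ring.
  by move: yab zab => /andP[? ?] /andP[? ?]; apply/andP; split; nra.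
have h1 := FG w y wab yab; have h2 := FG w z wab zab; have h3 := ymin w wab.
have h1' : F w - l * (G w * (z - y)) + l ^+ 2 * D <= F y.
  by apply: le_trans h1; rewrite le_eqVlt /D /w; apply/orP; left; apply/eqP; field.
have h2' : F w + (1 - l) * (G w * (z - y)) + (1 - l) ^+ 2 * D <= F z.
  by apply: le_trans h2; rewrite le_eqVlt /D /w; apply/orP; left; apply/eqP; field.
have : l * (F y + (1 - l) * D) <= l * F z.
  have := ler_wpM2l (ltW l0) h2'.
  have l1' : 0 <= 1 - l by rewrite subr_ge0.
  have := ler_wpM2l l1' h1'; lra.
by rewrite ler_pM2l// -/D => ?; lra.
Qed.

Lemma strongly_convex_argmin_exists M a b F G : 0 <= M -> a <= b ->
  strongly_convex_on M a b F G -> exists y, argmin_set F [set x | a <= x <= b] y.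
Proof.
move=> M0 ab FG.
have [y yab ymin] := EVT_min ab (strongly_convex_on_continuous M0 FG).
exists y; split => [|z zab]; first by move: yab; rewrite in_itv.
by apply: ymin; rewrite in_itv.
Qed.

(** Each of [y], [y'] minimizes its own function, and the quadratic growth
    applies to both; in the sum of the two inequalities [F] cancels and
    [M * (y' - y) ^+ 2 <= - c * (y' - y)] remains. *)
Lemma strongly_convex_argmin_lipschitz M a b F F' G G' c y y' : 0 < M ->
    strongly_convex_on M a b F G -> strongly_convex_on M a b F' G' ->
    (forall z, F' z = F z + c * z) ->
    argmin_set F [set x | a <= x <= b] y ->
    argmin_set F' [set x | a <= x <= b] y' ->
  `|y' - y| <= M^-1 * `|c|.
Proof.
move=> M0 FG FG' FF' yF yF'.
have h1 := strongly_convex_argmin_growth FG yF yF'.1.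
have h2 := strongly_convex_argmin_growth FG' yF' yF.1.
rewrite !FF' in h2.
have h : M * (y' - y) ^+ 2 <= - c * (y' - y).
  have e1 : - c * (y' - y) = c * y - c * y' by ring.
  by move: h1 h2; rewrite -[(y - y') ^+ 2]sqrrN opprB e1; lra.
rewrite mulrC ler_pdivlMr// mulrC.
have [->|yy'] := eqVneq y' y; first by rewrite subrr normr0 mulr0.
have d0 : 0 < `|y' - y| by rewrite normr_gt0 subr_eq0.
rewrite -(ler_pM2r d0) -mulrA -expr2 real_normK ?num_real//.
by apply: le_trans h _; rewrite -normrM -[leRHS]normrN -mulNr ler_norm.
Qed.

End StrongConvexity.

(** * The inverse of a control function *)

Section Inverse.
Context {R : realType}.
Implicit Types (al d : R) (f : R -> R).

Lemma derive1_bound_lipschitz al f u v : u <= v ->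
    (forall w, u <= w <= v -> derivable f w 1 /\ `|derive1 f w| <= al) ->
  f u - f v <= al * (v - u).
Proof.
move=> uv fP.
have [w|t|w] := @MVT_segment _ f (derive1 f) u v uv.
- rewrite in_itv/= => /andP[uw wv]; rewrite derive1E.
  by apply: derivableP; apply: (fP w _).1; rewrite !ltW.
- apply: continuous_in_subspaceT => w; rewrite inE/= in_itv/= => wuv.
  by apply/differentiable_continuous/derivable1_diffP; exact: (fP w wuv).1.
- rewrite in_itv/= => /(fP _)[_ wal] E.
  rewrite -opprB E -mulNr ler_wpM2r ?subr_ge0//.
  by apply: le_trans wal; rewrite -normrN ler_norm.
Qed.

(** [f] could jump at the threshold [d], as only its behaviour to the left of
    [d] is controlled.  A jump would leave small positive values unattained:
    taking [w] with [f w = e] for small [e] moves the endpoint [v] back to the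
    left of [d] at the price of [e]. *)
Lemma lipschitz_across_threshold al d f u v : 0 <= al ->
    (forall s t, s <= t -> f t <= f s) -> f d = 0 ->
    (forall s t, s <= t -> t < d -> f s - f t <= al * (t - s)) ->
    (forall q, 0 < q <= f u -> exists w, f w = q) -> u <= v -> d <= v ->
  f u <= al * (v - u).
Proof.
move=> al0 fmono fd0 flip fsurj uv dv.
have [fu0|fu0] := leP (f u) 0.
  by apply: le_trans fu0 _; rewrite mulr_ge0// subr_ge0.
apply/ler_addgt0Pr => e e0.
have [eu|ue] := leP (f u) e.
  by apply: le_trans eu _; rewrite lerDr mulr_ge0// subr_ge0.
have [w fw] : exists w, f w = e by apply: fsurj; rewrite e0 ltW.
have wd : w < d.
  by rewrite ltNge; apply/negP => /fmono; rewrite fw fd0; lra.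
have uw : u <= w.
  by rewrite leNgt; apply/negP => /ltW/fmono; rewrite fw; lra.
have := flip u w uw wd; rewrite fw => h.
have : al * (w - u) <= al * (v - u) by rewrite ler_wpM2l//; lra.
lra.
Qed.

Lemma finvP f q : (exists u, f u = q) -> f (finv f q) = q.
Proof. by move=> [u fu]; exact: (@xgetPex _ 0 [set w | f w = q]  (ex_intro _ u fu)). Qed.

(** The claim is the slope bound for [f] read off at [finv f q] and
    [finv f r].  If these lie on the same side of the deadband it is the mean
    value theorem; otherwise a point of the deadband between them splits the
    segment in two, each half being an instance of
    [lipschitz_across_threshold], for [f] and for its reflection
    [fun x => - f (- x)]. *)
Lemma finv_strongly_decreasing al d f a b : 0 < al -> 0 <= d -> a <= 0 -> 0 <= b ->
    (forall u, - d <= u <= d -> f u = 0) ->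
    (forall u v, u <= v -> f v <= f u) ->
    (forall u, u < - d \/ d < u -> derivable f u 1) ->
    (forall u, u < - d \/ d < u -> `|derive1 f u| <= al) ->
    (forall q, a <= q <= b -> q != 0 -> exists u, f u = q) ->
  strongly_decreasing_on al^-1 a b (finv f).
Proof.
move=> al0 d0 a0 b0 f0 fmono df dfal fsurj.
have f00 : f 0 = 0 by apply: f0; rewrite oppr_le0 d0.
have {}fsurj q : a <= q <= b -> exists u, f u = q.
  by move=> qab; have [->|q0] := eqVneq q 0; [exists 0|exact: fsurj].
have flipL s t : s <= t -> t < - d -> f s - f t <= al * (t - s).
  move=> st td; apply: derive1_bound_lipschitz => // w /andP[sw wt].
  by split; [apply: df|apply: dfal]; left; exact: le_lt_trans td.
have flipR s t : s <= t -> d < s -> f s - f t <= al * (t - s).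
  move=> st ds; apply: derive1_bound_lipschitz => // w /andP[sw wt].
  by split; [apply: df|apply: dfal]; right; exact: lt_le_trans sw.
have crossL u v : a <= f u <= b -> u <= v -> - d <= v -> f u <= al * (v - u).
  move=> /andP[afu fub]; apply: (lipschitz_across_threshold (ltW al0) fmono _ flipL).
    by apply: f0; rewrite lexx ge0_cp.
  by move=> q /andP[q0 qfu]; apply: fsurj; apply/andP; split; lra.
have crossR u v : a <= f v <= b -> u <= v -> u <= d -> - f v <= al * (v - u).
  move=> /andP[afv fvb] uv ud.
  pose fo x := - f (- x).
  have -> : - f v = fo (- v) by rewrite /fo opprK.
  have -> : v - u = - u - - v by rewrite opprK addrC.
  apply: (@lipschitz_across_threshold al (- d) fo) => //.
  - exact: ltW.
  - by move=> s t st; rewrite /fo lerN2; apply: fmono; rewrite lerN2.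
  - by rewrite /fo opprK f0 ?oppr0// lexx andbT ge0_cp.
  - move=> s t st td; rewrite /fo.
    have := flipR (- t) (- s); rewrite lerN2 ltrNr => /(_ st td); lra.
  - move=> q; rewrite /fo opprK => /andP[q0 qv].
    have [|w fw] := fsurj (- q); first by apply/andP; split; lra.
    by exists (- w); rewrite opprK fw opprK.
  - by rewrite lerN2.
  - by rewrite lerN2.
have flip u v : a <= f u <= b -> a <= f v <= b -> u <= v ->
    f u - f v <= al * (v - u).
  move=> fuab fvab uv.
  have [vd|dv] := ltP v (- d); first exact: flipL.
  have [du|ud] := ltP d u; first exact: flipR.
  (* w lies in the deadband, between u and v *)
  pose w := Num.max u (- d).
  have fw : f w = 0 by apply: f0; rewrite le_max lexx orbT ge_max ud ge0_cp.
  have uw : u <= w by rewrite le_max lexx.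
  have wv : w <= v by rewrite ge_max uv.
  have := crossL u w fuab uw; rewrite le_max lexx orbT => /(_ isT).
  have := crossR w v fvab wv; rewrite ge_max ud ge0_cp// => /(_ isT).
  by rewrite !mulrBr; lra.
move=> q r aq qr rb.
have fq : f (finv f q) = q by apply/finvP/fsurj; rewrite aq (le_trans qr).
have fr : f (finv f r) = r by apply/finvP/fsurj; rewrite rb (le_trans aq).
move: qr; rewrite le_eqVlt => /predU1P[->|qr].
  by rewrite subrr mulr0 addr0.
have rq : finv f r <= finv f q.
  by rewrite leNgt; apply/negP => /ltW/fmono; rewrite fq fr leNgt qr.
have := flip _ _ _ _ rq; rewrite fq fr rb (ltW (le_lt_trans aq qr)) aq.
rewrite (ltW (lt_le_trans qr rb)) => /(_ isT isT) h.
by rewrite -lerBrDl ler_pdivrMl.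
Qed.
End Inverse.

(** * The Euclidean norm and the largest singular value *)

Section LinAlg.
Context {R : realType}.

Definition dot n (u v : 'cV[R]_n) : R := (u^T *m v) 0 0.

Lemma dotE n (u v : 'cV[R]_n) : dot u v = \sum_i u i 0 * v i 0.
Proof. by rewrite /dot mxE; apply: eq_bigr => i _; rewrite mxE. Qed.

Lemma dotC n (u v : 'cV[R]_n) : dot u v = dot v u.
Proof. by rewrite !dotE; apply: eq_bigr => i _; rewrite mulrC. Qed.

Lemma dotDr n (u v w : 'cV[R]_n) : dot u (v + w) = dot u v + dot u w.
Proof. by rewrite /dot mulmxDr mxE. Qed.

Lemma dotZr n (a : R) (u v : 'cV[R]_n) : dot u (a *: v) = a * dot u v.
Proof. by rewrite /dot -scalemxAr mxE. Qed.

Lemma dotDl n (u v w : 'cV[R]_n) : dot (u + v) w = dot u w + dot v w.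
Proof. by rewrite !(dotC _ w) dotDr. Qed.

Lemma dotZl n (a : R) (u v : 'cV[R]_n) : dot (a *: u) v = a * dot u v.
Proof. by rewrite !(dotC _ v) dotZr. Qed.

Lemma dot_mulmx m n (A : 'M[R]_(m, n)) u v : dot (A *m u) v = dot u (A^T *m v).
Proof. by rewrite /dot trmx_mul mulmxA. Qed.

Lemma dotvv_ge0 n (u : 'cV[R]_n) : 0 <= dot u u.
Proof. by rewrite dotE sumr_ge0// => i _; rewrite -expr2 sqr_ge0. Qed.

Lemma dotvv_eq0 n (u : 'cV[R]_n) : (dot u u == 0) = (u == 0).
Proof.
apply/eqP/eqP => [|->]; last by rewrite /dot mulmx0 mxE.
rewrite dotE => /eqP; rewrite psumr_eq0 => [/allP u0|i _]; last first.
  by rewrite -expr2 sqr_ge0.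
apply/matrixP => i j; rewrite ord1 mxE; apply/eqP.
by have := u0 i (mem_index_enum _); rewrite /= -expr2 sqrf_eq0.
Qed.

Lemma norm2_dot n (u : 'cV[R]_n) : norm2 u = Num.sqrt (dot u u).
Proof. by rewrite /norm2 dotE. Qed.

Lemma norm2_ge0 n (u : 'cV[R]_n) : 0 <= norm2 u.
Proof. exact: sqrtr_ge0. Qed.

Lemma norm2_eq0 n (u : 'cV[R]_n) : (norm2 u == 0) = (u == 0).
Proof. by rewrite norm2_dot sqrtr_eq0 -dotvv_eq0 eq_le dotvv_ge0 andbT. Qed.

Lemma normr_le_norm2 n (u : 'cV[R]_n) : `|u| <= norm2 u.
Proof.
rewrite [leLHS]/Num.norm/= mx_normrE; apply: bigmax_le => [|[i j] _ /=].
  exact: norm2_ge0.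
rewrite ord1 -sqrtr_sqr ler_wsqrtr// (bigD1 i)//= lerDl sumr_ge0// => k _.
exact: sqr_ge0.
Qed.

Lemma norm2_le n (u v : 'cV[R]_n) :
  (forall i, `|u i 0| <= `|v i 0|) -> norm2 u <= norm2 v.
Proof.
move=> uv; apply: ler_wsqrtr; apply: ler_sum => i _.
by rewrite -(real_normK (num_real (u i 0))) -(real_normK (num_real (v i 0)))
           lerXn2r ?nnegrE.
Qed.

Lemma dot_continuous m n (A : 'M[R]_(m, n)) :
  continuous (fun u : 'cV[R]_n => dot (A *m u) (A *m u)).
Proof.
rewrite (_ : (fun u : 'cV[R]_n => _) =
  fun u : 'cV[R]_n => \sum_i (\sum_j A i j * u j 0) ^+ 2); last first.
  by apply/funext => v; rewrite dotE; apply: eq_bigr => i _; rewrite -expr2 mxE.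
have cD : continuous (fun z : R * R => z.1 + z.2).
  by exact: add_continuous.
apply: (continuous_big cD) => i _ u.
apply: (@continuous_comp _ _ _ (fun v : 'cV[R]_n => \sum_j A i j * v j 0)
          (fun t : R => t ^+ 2)); last exact: exprn_continuous.
apply: (continuous_big cD) => j _ v.
exact: (cvgM (cvg_cst (A i j)) (@coord_continuous R n 1 j 0 v)).
Qed.

Lemma norm2_continuous n : continuous (@norm2 R n).
Proof.
move=> u; rewrite (_ : @norm2 R n = Num.sqrt \o (fun v => dot (1%:M *m v) (1%:M *m v))).
  by apply: continuous_comp; [exact: dot_continuous|exact: sqrt_continuous].
by apply/funext => v; rewrite /= !mul1mx norm2_dot.
Qed.

Lemma trmx_continuous m n : continuous (@trmx R m n).
Proof.
move=> /= M s /= /(nbhs_ballP (M^T)) [e e0 es].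
apply/nbhs_ballP; exists e => //= N [_ MN]; apply: es.
by split => // i j; rewrite !mxE; exact: MN.
Qed.

Lemma profiles_compact n (a b : 'I_n -> R) : compact (profiles a b).
Proof.
have -> : profiles a b =
    @trmx R 1 n @` [set v : 'rV[R]_n | forall i, [set` `[a i, b i]] (v 0 i)].
  apply/seteqP; split => [q qP|_ [v vP <-] i]; last first.
    by have := vP i; rewrite /= in_itv/= /strategy/= mxE.
  exists q^T; last by rewrite trmxK.
  by move=> i; rewrite /= mxE in_itv; exact: qP.
apply: continuous_compact; first exact/continuous_subspaceT/trmx_continuous.
by apply: (@rV_compact R n (fun i => `[a i, b i]%classic)) => i; exact: segment_compact.
Qed.

Lemma unit_sphere_compact n : compact [set u : 'cV[R]_n | norm2 u = 1].
Proof.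
apply: (@subclosed_compact _ _ (profiles (fun=> -1) (fun=> 1))).
- rewrite (_ : mkset _ = @norm2 R n @^-1` [set 1])//.
  apply: preimage_closed; first by move=> u _; exact: norm2_continuous.
  exact: closed_eq.
- exact: profiles_compact.
- move=> u /= u1 i; rewrite /strategy/= -ler_norml -u1.
  rewrite -sqrtr_sqr ler_wsqrtr// (bigD1 i)//= lerDl sumr_ge0// => k _.
  exact: sqr_ge0.
Qed.

(** A maximizer [u] of the Rayleigh quotient is an eigenvector: comparing [u]
    with [u + t *: r], where [r] is the residual, the first order term in [t]
    is [2 * t * dot r r], which must not be positive. *)
Lemma rayleigh_max_eigen m n (A : 'M[R]_(m, n)) (u : 'cV[R]_n) (l : R) :
    (forall w, dot (A *m w) (A *m w) <= l * dot w w) ->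
    dot (A *m u) (A *m u) = l * dot u u -> 0 <= l ->
  A^T *m A *m u = l *: u.
Proof.
move=> ub uE l0; apply/eqP; rewrite -subr_eq0 -dotvv_eq0 eq_le dotvv_ge0 andbT.
set r := _ - _.
(* the first order term dominates once t * l <= 1 *)
pose t := (l + 1)^-1.
have t0 : 0 < t by rewrite invr_gt0; lra.
have rE : dot (A *m u) (A *m r) = dot r r + l * dot u r.
  by rewrite dotC dot_mulmx mulmxA (dotC u r) -dotZr -dotDr subrK.
have := ub (u + t *: r); move: r rE => r rE.
rewrite mulmxDr -scalemxAr !dotDr !dotDl !dotZr !dotZl.
rewrite uE (dotC (A *m r) (A *m u)) (dotC r u) rE => h.
have {h} : t * (2 * dot r r + t * dot (A *m r) (A *m r)) <= t * (t * l * dot r r).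
  by lra.
rewrite ler_pM2l// => h.
have tl : t * l <= 1 by rewrite mulrC ler_pdivrMr; lra.
have := ler_wpM2r (dotvv_ge0 r) tl.
have : 0 <= t * dot (A *m r) (A *m r) by rewrite mulr_ge0 ?dotvv_ge0// ltW.
lra.
Qed.

Lemma trmx_gram m n (A : 'M[R]_(m, n)) : (A^T *m A)^T = A^T *m A.
Proof. by rewrite trmx_mul trmxK. Qed.

Lemma eigenvalue_gram m n (A : 'M[R]_(m, n)) l (u : 'cV[R]_n) : u != 0 ->
  A^T *m A *m u = l *: u -> eigenvalue (A^T *m A) l.
Proof.
move=> u0 uE; apply/eigenvalueP; exists u^T; last by rewrite trmx_eq0.
by apply: trmx_inj; rewrite trmx_mul trmxK trmx_gram uE linearZ/= trmxK.
Qed.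

(** The maximum [l] of [dot (A *m w) (A *m w)] on the unit sphere is an
    eigenvalue of the Gram matrix, and it bounds all the others, so the
    supremum in [sigma_max A] is over a bounded set that contains
    [Num.sqrt l]. *)
Lemma norm2_mulmx_le n (A : 'M[R]_n) (v : 'cV[R]_n) :
  norm2 (A *m v) <= sigma_max A * norm2 v.
Proof.
have [->|v0] := eqVneq v 0.
  by rewrite mulmx0 (eqP (_ : norm2 0 == 0)) ?mulr0 ?norm2_eq0.
have normalize (w : 'cV[R]_n) : w != 0 -> norm2 ((norm2 w)^-1 *: w) = 1.
  move=> w0; have nw0 : norm2 w != 0 by rewrite norm2_eq0.
  rewrite norm2_dot dotZr dotZl mulrA -expr2 sqrtrM ?sqr_ge0//.
  by rewrite sqrtr_sqr -norm2_dot ger0_norm ?invr_ge0 ?norm2_ge0// mulVf.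
have [||u + umax] := @compact_EVT_max _ _
    (fun w : 'cV[R]_n => dot (A *m w) (A *m w)) _ _ (@unit_sphere_compact n).
- by exists ((norm2 v)^-1 *: v); exact: normalize.
- exact/continuous_subspaceT/dot_continuous.
rewrite inE/= => u1.
have uu1 : dot u u = 1.
  by rewrite -[LHS]sqr_sqrtr ?dotvv_ge0// -norm2_dot u1 expr1n.
have u0 : u != 0 by rewrite -norm2_eq0 u1 oner_eq0.
pose l := dot (A *m u) (A *m u).
have l0 : 0 <= l by exact: dotvv_ge0.
have ub w : dot (A *m w) (A *m w) <= l * dot w w.
  have [->|w0] := eqVneq w 0; first by rewrite /dot !mulmx0 mxE mulr0.
  have nw : 0 < norm2 w by rewrite lt_neqAle norm2_ge0 eq_sym norm2_eq0 w0.
  have := umax ((norm2 w)^-1 *: w); rewrite inE/= normalize// => /(_ erefl).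
  rewrite -scalemxAr dotZr dotZl mulrA -expr2 -/l.
  rewrite exprVn -ler_pdivlMl ?invrK ?invr_gt0 ?exprn_gt0// mulrC.
  by rewrite norm2_dot sqr_sqrtr ?dotvv_ge0.
have lE : A^T *m A *m u = l *: u by apply: rayleigh_max_eigen => //; rewrite uu1 mulr1.
have sl : Num.sqrt l <= sigma_max A.
  apply: ub_le_sup; last by exists l => //=; exact: eigenvalue_gram lE.
  exists (Num.sqrt l) => _ [k /= /eigenvalueP[w wE w0] <-].
  apply: ler_wsqrtr.
  have wt0 : 0 < dot w^T w^T by rewrite lt_neqAle dotvv_ge0 eq_sym dotvv_eq0 trmx_eq0 w0.
  rewrite -(ler_pM2r wt0); apply: le_trans (ub w^T).
  by rewrite dot_mulmx mulmxA -{1}trmx_gram -trmx_mul wE linearZ/= dotZr.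
apply: le_trans (ler_wpM2r (norm2_ge0 v) sl).
by rewrite !norm2_dot -sqrtrM// ler_wsqrtr.
Qed.

Lemma sigma_max_ge0 n (A : 'M[R]_n) : 0 <= sigma_max A.
Proof.
case: n A => [|n] A; last first.
  pose e : 'cV[R]_n.+1 := const_mx 1.
  have e0 : 0 < norm2 e.
    rewrite lt_neqAle norm2_ge0 eq_sym norm2_eq0 andbT.
    by apply/eqP => /matrixP /(_ 0 0); rewrite !mxE; apply/eqP/oner_neq0.
  by rewrite -(pmulr_lge0 _ e0) (le_trans (norm2_ge0 _) (norm2_mulmx_le A e)).
rewrite /sigma_max [X in sup X](_ : _ = set0) ?sup0//.
apply/seteqP; split => // _ [l /= /eigenvalueP[w _ w0] _].
by case/eqP: w0; apply/rowP => -[].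
Qed.
End LinAlg.

(** * Contractions for the Euclidean norm *)

Section FixedPoint.
Context {R : realType} {n : nat}.
Variables (T : 'cV[R]_n -> 'cV[R]_n) (r : R).
Hypothesis Tr : forall u v, norm2 (T u - T v) <= r * norm2 (u - v).

Lemma norm2_contraction_continuous : 0 <= r -> continuous T.
Proof.
move=> r0 u; apply/(cvgrPdist_le (FF := nbhs_filter u)) => e e0; near=> v.
apply: le_trans (normr_le_norm2 _) _; apply: le_trans (Tr u v) _.
have h : r <= r + 1 by lra.
apply: le_trans (ler_wpM2r (norm2_ge0 _) h) _.
rewrite mulrC -ler_pdivlMr; last by lra.
rewrite -[leLHS]subr0 -[X in _ - X](_ : norm2 (u - u) = 0); last first.
  by apply/eqP; rewrite subrr norm2_eq0.
apply: le_trans (ler_norm _) _; rewrite distrC; near: v.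
apply: (@cvgr_dist_le _ _ _ _ (nbhs_filter u) (fun v => norm2 (u - v))).
  apply: (@continuous_cvg _ _ _ _ (nbhs_filter u) (fun v => u - v)).
    exact: norm2_continuous.
  exact: (cvgB (cvg_cst _) cvg_id).
by rewrite divr_gt0//; lra.
Unshelve. all: by end_near. Qed.

Lemma norm2_contraction_fixpoint_uniq u v : r < 1 -> T u = u -> T v = v -> u = v.
Proof.
move=> r1 Tu Tv; apply/eqP; rewrite -subr_eq0 -norm2_eq0 eq_le norm2_ge0 andbT.
have := Tr u v; rewrite Tu Tv => h.
by rewrite -(pmulr_rle0 _ (_ : 0 < 1 - r)); lra.
Qed.

(** The displacement [norm2 (T u - u)] attains its minimum on [A]; applying [T]
    to a minimizer multiplies the displacement by at most [r < 1], so the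
    minimum is 0.  (The norm of the topology is the maximum norm, for which [T]
    need not be a contraction.) *)
Lemma norm2_contraction_fixpoint (A : set 'cV[R]_n) : 0 <= r -> r < 1 ->
    A !=set0 -> compact A -> (forall u, A (T u)) ->
  exists u, T u = u.
Proof.
move=> r0 r1 A0 cA AT.
have [|u _ umin] := @compact_EVT_min _ _ (fun u => norm2 (T u - u)) A A0 cA.
  apply: continuous_subspaceT => u.
  apply: (@continuous_cvg _ _ _ _ (nbhs_filter u) (fun v => T v - v)).
    exact: norm2_continuous.
  exact: (cvgB (norm2_contraction_continuous r0 (x := u)) cvg_id).
exists u; apply/eqP; rewrite -subr_eq0 -norm2_eq0 eq_le norm2_ge0 andbT.
have h1 := umin (T u) (mem_set (AT u)); have h2 := Tr (T u) u.
by rewrite -(pmulr_rle0 _ (_ : 0 < 1 - r)); lra.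
Qed.

Lemma norm2_contraction_geometric (q : nat -> 'cV[R]_n) u : 0 <= r -> T u = u ->
    (forall t, q t.+1 = T (q t)) ->
  forall t, norm2 (q t - u) <= norm2 (q 0%N - u) * r ^+ t.
Proof.
move=> r0 Tu qT; elim=> [|t IH]; first by rewrite mulr1.
rewrite qT -{1}Tu exprS mulrCA.
by apply: le_trans (Tr _ _) _; rewrite ler_wpM2l.
Qed.
End FixedPoint.

Lemma exp_converges_cvg (R : realType) n (q : nat -> 'cV[R]_n) u :
  exp_converges q u -> q t @[t --> \oo] --> u.
Proof.
move=> [c [r [c0 /andP[r0 r1] qr]]].
apply/cvgrPdist_le => e e0; near=> t; rewrite distrC.
apply: le_trans (normr_le_norm2 _) _; apply: le_trans (qr t) _.
apply: le_trans (ler_norm _) _; rewrite -normrN -sub0r; near: t.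
apply: cvgr_dist_le => //.
by apply: (@cvg_geometric _ c r); rewrite ger0_norm.
Unshelve. all: by end_near. Qed.

(** * The voltage control game *)

Lemma reactance_mx_diag_ge0 (R : realType) n (L : {set {set 'I_n.+1}})
    (x : {set 'I_n.+1} -> R) i :
  (forall e, e \in L -> 0 < x e) -> 0 <= reactance_mx L x i i.
Proof.
move=> x0; rewrite mxE sumr_ge0// => e; rewrite finset.setIid inE => /andP[eL _].
exact/ltW/x0.
Qed.

Lemma diag_mx_offdiagE (R : realType) n (b : 'I_n -> R) (X : 'M[R]_n)
    (v : 'cV[R]_n) i :
  (diag_mx (\row_i b i) *m offdiag_mx X *m v) i 0 =
  b i * \sum_(j | j != i) X i j * v j 0.
Proof.
rewrite -mulmxA mul_diag_mx mxE !mxE; congr (_ * _).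
rewrite [RHS]big_mkcond/=; apply: eq_bigr => j _; rewrite mxE eq_sym.
by case: ifP => //; rewrite mul0r.
Qed.

Lemma game_cost_deviate (R : realType) n (f : 'I_n -> R -> R) (X : 'M[R]_n) dv q i y :
  game_cost f X dv i (deviate q i y) = anticipating_objective f X dv q i y.
Proof.
rewrite /game_cost /anticipating_objective mxE eqxx (bigD1 i)//= mxE eqxx.
by congr (_ + y * (_ + _ + _)); apply: eq_bigr => j /negbTE ji; rewrite mxE ji.
Qed.

Lemma deviate_id (R : realType) n (q : 'cV[R]_n) i : deviate q i (q i 0) = q.
Proof. by apply/colP => j; rewrite mxE; case: eqP => // ->. Qed.

(** The objective of the control counts the own term [X i i * y] at the new
    value [y], just as the game does for a deviation to [y]. *)
Lemma nash_equilibriumP (R : realType) n (qmin qmax : 'I_n -> R)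
    (f : 'I_n -> R -> R) (X : 'M[R]_n) dv q :
  nash_equilibrium qmin qmax f X dv q <->
  forall i, argmin_set (anticipating_objective f X dv q i)
              (strategy qmin qmax i) (q i 0).
Proof.
split=> [[qP qN] i|qN].
  split => [|y yP]; first exact: qP.
  by rewrite -!game_cost_deviate deviate_id; exact: qN.
split => [i|i y yP]; first by case: (qN i).
by rewrite -[X in game_cost _ _ _ _ X <= _](deviate_id q i) !game_cost_deviate;
  apply: (qN i).2.
Qed.

Section BestResponse.
Context {R : realType} {n : nat}.
Variables (dv : 'cV[R]_n) (m qmin qmax : 'I_n -> R) (f : 'I_n -> R -> R).
Variables (X : 'M[R]_n) (G : 'I_n -> R -> R).
Hypothesis qle : forall i, qmin i <= qmax i.
Hypothesis m_gt0 : forall i, 0 < m i.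
Hypothesis X_ge0 : forall i, 0 <= X i i.
Hypothesis C_convex : forall i,
  strongly_convex_on (m i) (qmin i) (qmax i) (node_cost (f i)) (G i).

Let modulus i := m i + 2 * X i i.

Let modulus_gt0 i : 0 < modulus i.
Proof. by rewrite ltr_wpDr// mulr_ge0. Qed.

Lemma objective_convex q i : exists G',
  strongly_convex_on (modulus i) (qmin i) (qmax i)
    (anticipating_objective f X dv q i) G'.
Proof.
have := strongly_convex_onD_quadratic (X i i)
          (\sum_(j | j != i) X i j * q j 0 + dv i 0) (@C_convex i).
rewrite (_ : (fun y => _) = anticipating_objective f X dv q i).
  by move=> h; exists (fun y => G i y + 2 * X i i * y +
    (\sum_(j | j != i) X i j * q j 0 + dv i 0)).
by apply/funext => y; rewrite /anticipating_objective addrA.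
Qed.

Lemma best_response_unique q i :
  exists! y, argmin_set (anticipating_objective f X dv q i)
               (strategy qmin qmax i) y.
Proof.
have [G' FG] := objective_convex q i.
have [y yP] := strongly_convex_argmin_exists (ltW (modulus_gt0 i)) (qle i) FG.
exists y; split => // z zP.
have := strongly_convex_argmin_lipschitz (c := 0) (modulus_gt0 i) FG FG _ zP yP.
rewrite normr0 mulr0 normr_le0 subr_eq0 => h; apply/eqP/h => w.
by rewrite mul0r addr0.
Qed.

Definition best_response q : 'cV[R]_n :=
  \col_i xget 0 (argmin_set (anticipating_objective f X dv q i)
                   (strategy qmin qmax i)).

Lemma best_responseP q i y :
  argmin_set (anticipating_objective f X dv q i) (strategy qmin qmax i) y <->
  y = best_response q i 0.
Proof.
have [z [zP zU]] := best_response_unique q i.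
have bz : best_response q i 0 = z.
  by rewrite mxE; case: xgetP => [w _ /zU//|/(_ z)].
by rewrite bz; split=> [/zU//|->].
Qed.

(** Passing from [q] to [p] tilts the objective of node [i] by the off-diagonal
    interaction with [p - q], and leaves its modulus unchanged. *)
Lemma best_response_contraction p q :
  norm2 (best_response p - best_response q) <=
  sigma_max (diag_mx (\row_i (modulus i)^-1) *m offdiag_mx X) * norm2 (p - q).
Proof.
apply: le_trans (norm2_mulmx_le _ _); apply: norm2_le => i.
rewrite diag_mx_offdiagE normrM ger0_norm ?invr_ge0 ?(ltW (modulus_gt0 i))//.
have [Gp Fp] := objective_convex p i; have [Gq Fq] := objective_convex q i.
have := strongly_convex_argmin_lipschitz
  (c := \sum_(j | j != i) X i j * (p - q) j 0) (modulus_gt0 i) Fq Fp.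
move=> /(_ (best_response q i 0) (best_response p i 0)).
have -> : (best_response p - best_response q) i 0 =
    best_response p i 0 - best_response q i 0 by rewrite !mxE.
apply.
- move=> z; rewrite /anticipating_objective [X in _ + X * z](_ : _ =
    \sum_(j | j != i) X i j * p j 0 - \sum_(j | j != i) X i j * q j 0).
    by ring.
  by rewrite -sumrB; apply: eq_bigr => j _; rewrite !mxE mulrBr.
- exact/best_responseP.
- exact/best_responseP.
Qed.

Lemma nash_best_response q :
  nash_equilibrium qmin qmax f X dv q <-> best_response q = q.
Proof.
split=> [/nash_equilibriumP qN|qT].
  by apply/colP => i; apply/esym/best_responseP.
by apply/nash_equilibriumP => i; apply/best_responseP; rewrite qT.
Qed.

Lemma best_response_profile q : profiles qmin qmax (best_response q).
Proof.
by move=> i; have /best_responseP[] : best_response q i 0 = best_response q i 0.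
Qed.
End BestResponse.

Theorem theorem4 (R : realType) (n : nat)
  (L : {set {set 'I_n.+1}}) (x : {set 'I_n.+1} -> R)
  (dv : 'cV[R]_n) (delta alpha qmin qmax : 'I_n -> R) (f : 'I_n -> R -> R)
  (L_tree : is_tree L)
  (x_gt0 : forall e, e \in L -> 0 < x e)
  (delta_ge0 : forall i, 0 <= delta i)
  (qmin_le_qmax : forall i, qmin i <= qmax i)
  (f_deadband : forall i (u : R), - (delta i / 2) <= u <= delta i / 2 -> f i u = 0)
  (f_nonincreasing : forall i (u v : R), u <= v -> f i v <= f i u)
  (f_decreasing : forall i (u v : R), u < - (delta i / 2) \/ delta i / 2 < u ->
     v < - (delta i / 2) \/ delta i / 2 < v -> u < v -> f i v < f i u)
  (f_derivable : forall i (u : R), u < - (delta i / 2) \/ delta i / 2 < u ->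
     derivable (f i) u 1)
  (f_slope : forall i (u : R), u < - (delta i / 2) \/ delta i / 2 < u ->
     `| derive1 (f i) u | <= alpha i)
  (* [f i] is invertible at all nonzero points between 0 and [strategy i] *)
  (f_inverse : forall i (y q : R), strategy qmin qmax i y ->
     0 < q <= y \/ y <= q < 0 -> exists u, f i u = q) :
  let X := reactance_mx L x in
  let B := diag_mx (\row_i (1 / (1 / alpha i + 2 * X i i))) in
  sigma_max (B *m offdiag_mx X) < 1 ->
  (* the minimization problems defining the control have unique solutions *)
  (forall (q : 'cV[R]_n) (i : 'I_n), profiles qmin qmax q ->
     exists! y, argmin_set (anticipating_objective f X dv q i)
                  (strategy qmin qmax i) y) /\
  exists qa : 'cV[R]_n,
    [/\ nash_equilibrium qmin qmax f X dv qa,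
        (forall qb, nash_equilibrium qmin qmax f X dv qb -> qb = qa)
      & forall q : nat -> 'cV[R]_n,
          anticipating_control qmin qmax f X dv q ->
          (q t @[t --> \oo] --> qa) /\ exp_converges q qa].
Proof.
move=> X B sigma_lt1.
have alpha_gt0 i : 0 < alpha i.
  (* a slope bound of 0 would make f i constant beyond its deadband *)
  pose u := delta i / 2 + 1; pose v := delta i / 2 + 2.
  have du : delta i / 2 < u by rewrite /u; lra.
  have dv' : delta i / 2 < v by rewrite /v; lra.
  have uv : u < v by rewrite /u /v; lra.
  have fuv := f_decreasing i u v (or_intror du) (or_intror dv') uv.
  have := @derive1_bound_lipschitz _ (alpha i) (f i) u v (ltW uv).
  rewrite (_ : v - u = 1); last by rewrite /u /v; ring.
  rewrite mulr1 => fal; apply: lt_le_trans (fal _); first by rewrite subr_gt0.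
  move=> w /andP[uw _]; have dw := lt_le_trans du uw.
  by split; [apply: f_derivable|apply: f_slope]; right.
have X_ge0 i : 0 <= X i i by exact: reactance_mx_diag_ge0.
have C_convex i : strongly_convex_on (alpha i)^-1 (qmin i) (qmax i)
    (node_cost (f i)) (fun y => - finv (f i) y).
  have ia : 0 <= (alpha i)^-1 by rewrite invr_ge0 ltW.
  have lo0 : Num.min 0 (qmin i) <= 0 by rewrite ge_min lexx.
  have hi0 : 0 <= Num.max 0 (qmax i) by rewrite le_max lexx.
  (* the smallest segment that contains 0 and the strategies of the node *)
  apply: (@strongly_convex_onS _ _ (Num.min 0 (qmin i)) (Num.max 0 (qmax i))).
  - by rewrite ge_min lexx orbT.
  - by rewrite le_max lexx orbT.
  apply: oriented_integral_strongly_convex => //.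
  apply: (@finv_strongly_decreasing _ _ (delta i / 2)) => //.
  - by rewrite divr_ge0.
  - exact: f_deadband.
  - exact: f_nonincreasing.
  - exact: f_derivable.
  - exact: f_slope.
  - move=> q /andP[loq qhi] q0.
    have [qneg|qpos] := ltP q 0.
      apply: (f_inverse i (qmin i)); first by rewrite /strategy/= lexx qmin_le_qmax.
      by right; move: loq; rewrite ge_min (leNgt 0 q) qneg /= => ->.
    apply: (f_inverse i (qmax i)); first by rewrite /strategy/= lexx andbT qmin_le_qmax.
    have {}qpos : 0 < q by rewrite lt_neqAle eq_sym q0.
    by left; move: qhi; rewrite le_max (leNgt q 0) qpos /= => ->.
have ialpha_gt0 i : 0 < (alpha i)^-1 by rewrite invr_gt0.
pose T := best_response dv qmin qmax f X.
pose r := sigma_max (B *m offdiag_mx X).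
have r0 : 0 <= r by exact: sigma_max_ge0.
have Tr p q : norm2 (T p - T q) <= r * norm2 (p - q).
  rewrite /r (_ : B = diag_mx (\row_i ((alpha i)^-1 + 2 * X i i)^-1)).
    exact: (best_response_contraction dv qmin_le_qmax ialpha_gt0 X_ge0 C_convex).
  by congr diag_mx; apply/rowP => i; rewrite !mxE !div1r.
have TP q i y : argmin_set (anticipating_objective f X dv q i)
    (strategy qmin qmax i) y <-> y = T q i 0.
  exact: (best_responseP dv qmin_le_qmax ialpha_gt0 X_ge0 C_convex).
have TN q : nash_equilibrium qmin qmax f X dv q <-> T q = q.
  exact: (nash_best_response dv qmin_le_qmax ialpha_gt0 X_ge0 C_convex).
split.
  move=> q i _.
  exact: (best_response_unique dv qmin_le_qmax ialpha_gt0 X_ge0 C_convex).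
have TA u : profiles qmin qmax (T u).
  exact: (best_response_profile dv qmin_le_qmax ialpha_gt0 X_ge0 C_convex u).
have cA : compact (profiles qmin qmax) by exact: profiles_compact.
have A0 : profiles qmin qmax !=set0.
  by exists (\col_i qmin i) => i; rewrite /strategy/= mxE lexx qmin_le_qmax.
have [qa Tqa] := norm2_contraction_fixpoint Tr r0 sigma_lt1 A0 cA TA.
exists qa; split; first exact/TN.
  move=> qb /TN Tqb.
  exact: (norm2_contraction_fixpoint_uniq Tr sigma_lt1 Tqb Tqa).
move=> q [_ qN].
have qT t : q t.+1 = T (q t) by apply/colP => i; apply/TP/qN.
have qexp : exp_converges q qa.
  exists (norm2 (q 0%N - qa)), r; split; first exact: norm2_ge0.
    by rewrite r0.
  exact: (norm2_contraction_geometric Tr r0 Tqa qT).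
by split => //; exact: exp_converges_cvg.
Qed.
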